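(* Let $H$ be a Hopf algebra with bijective antipode, $A$ a (nonzero) Poisson $H$-simple right $H$-comodule Poisson 3-Lie algebra, and $M$ a Poisson 3-Lie $(A,H)$-Hopf module. Assume that there exists a right $H$-colinear map $\phi:H\to A^A$ which is also an algebra map, and that $M^{coH}$ and $A^{coH}$ are trivial 3-Lie $A$-modules under $\diamond'$, i.e. $(x,y)\diamond' m=0$ for all $x,y\in A$, $m\in M^{coH}$ and $(x,y)\diamond' a=0$ for all $x,y\in A$, $a\in A^{coH}$. Then $M$ is free as an $A$-module, with rank equal to the dimension of $M^{AcoH}$ over the field $A^{AcoH}$.
   Context: Everything is over a fixed field $k$ of characteristic 0; algebras are associative and unital and algebra maps are unital. $H$ is a Hopf algebra with antipode $S$ and $\Delta(h)=h_1\otimes h_2$; right $H$-coactions are written $\rho(m)=m_{(0)}\otimes m_{(1)}$, and $M^{coH}=\{m\in M: \rho(m)=m\otimes 1_H\}$. $H$ is a right $H$-comodule via $\Delta$. A 3-Lie algebra is a vector space $A$ with a skew-symmetric trilinear bracket $\{-,-,-\}:A^{\otimes 3}\to A$ satisfying $\{\{x,y,z\},u,v\}=\{\{x,u,v\},y,z\}+\{\{y,u,v\},z,x\}+\{\{z,u,v\},x,y\}$. A 3-Lie $A$-module is a vector space $M$ with a trilinear map $A\times A\times M\to M$, $(x,y,m)\mapsto (x,y)\diamond m$, such that $(x,y)\diamond m=-(y,x)\diamond m$; $(x,y)\diamond((u,v)\diamond m)-(u,v)\diamond((x,y)\diamond m)=(\{x,y,u\},v)\diamond m+(u,\{x,y,v\})\diamond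 m$; $(\{x,y,u\},v)\diamond m=(y,u)\diamond((x,v)\diamond m)-(x,u)\diamond((y,v)\diamond m)+(x,y)\diamond((u,v)\diamond m)$. A Poisson 3-Lie algebra is a commutative associative algebra $A$ with a 3-Lie bracket such that $\{x,y,uv\}=u\{x,y,v\}+\{x,y,u\}v$. A Poisson 3-Lie $A$-module is an $A$-module $(M,\cdot)$ which is also a 3-Lie $A$-module $(M,\diamond)$ with $(xy,z)\diamond m=x\cdot((y,z)\diamond m)+y\cdot((x,z)\diamond m)$ and $(x,y)\diamond(z\cdot m)=\{x,y,z\}\cdot m+z\cdot((x,y)\diamond m)$. A right $H$-comodule Poisson 3-Lie algebra is a Poisson 3-Lie algebra $A$ that is a right $H$-comodule algebra with $\rho(\{x,y,z\})=\{x_{(0)},y_{(0)},z_{(0)}\}\otimes x_{(1)}y_{(1)}z_{(1)}$. A Poisson 3-Lie $(A,H)$-Hopf module is a Poisson 3-Lie $A$-module $M$ that is an $(A,H)$-Hopf module (a left $A$-module and right $H$-comodule with $\rho(a\cdot m)=a_{(0)}\cdot m_{(0)}\otimes a_{(1)}m_{(1)}$) such that $\rho((x,y)\diamond m)=(x_{(0)},y_{(0)})\diamond m_{(0)}\otimes x_{(1)}y_{(1)}m_{(1)}$. $A$ itself is such a module with $(x,y)\diamond a=\{x,y,a\}$. Invariants: $A^A=\{b\in A:\{b,A,A\}=0\}$ (a subalgebra and $H$-subcomodule of $A$), $M^A=\{m\in M:(x,y)\diamond m=0\ \forall x,y\in A\}$, $A^{AcoH}=A^A\cap A^{coH}$,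 $M^{AcoH}=M^A\cap M^{coH}$ (an $A^{AcoH}$-submodule of $M$). Given $\phi$, define $p_M:M\to M$, $p_M(m)=\phi(S^{-1}(m_{(1)}))\cdot m_{(0)}$, and $(x,y)\diamond' m=p_M((x,y)\diamond m)$; in particular, for $M=A$, $(x,y)\diamond' a=p_A(\{x,y,a\})$. A subspace $I$ of $A$ is a Poisson 3-Lie $H$-ideal if it is an ideal of the commutative algebra $A$, a 3-Lie ideal ($\{I,A,A\}\subseteq I$), and an $H$-subcomodule. $A$ is Poisson $H$-simple if its only Poisson 3-Lie $H$-ideals are $0$ and $A$; in that case (with $A\ne 0$) $A^{AcoH}$ is a field. *)

(* Defs.v *)
From HB Require Import structures.
From mathcomp Require Import all_boot all_algebra.
From mathcomp Require Import boolp classical_sets functions cardinality.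

Set Implicit Arguments.
Unset Strict Implicit.
Unset Printing Implicit Defensive.

Import GRing.Theory.
Local Open Scope ring_scope.
Local Open Scope classical_set_scope.
Local Open Scope quotient_scope.

(* The tensor product U ⊗ V over k.  An element is a class of finite formal   *)
(* sums of pairs (u, v), two formal sums being identified when every bilinear *)
(* map gives them the same value; the universal property is proved below      *)
(* (tsum_is_linear, tsum_pure, tens_ext).                                     *)
Section Tensor.
Variables (k : fieldType) (U V : lmodType k).
Implicit Types s t : seq (U * V).

Definition fsum (W : zmodType) (f : U -> V -> W) s : W :=
  \sum_(p <- s) f p.1 p.2.

Definition tens_eqv : rel (seq (U * V)) := fun s t =>
  `[< forall (W : lmodType k) (f : {bilinear U -> V -> W}),
        fsum f s = fsum f t >].

Lemma tens_eqvP s t :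
  reflect (forall (W : lmodType k) (f : {bilinear U -> V -> W}),
             fsum f s = fsum f t) (tens_eqv s t).
Proof. exact: asboolP. Qed.

Lemma tens_eqv_refl : reflexive tens_eqv.
Proof. by move=> s; apply/tens_eqvP. Qed.

Lemma tens_eqv_sym : symmetric tens_eqv.
Proof. by move=> s t; apply/tens_eqvP/tens_eqvP => h W f; rewrite h. Qed.

Lemma tens_eqv_trans : transitive tens_eqv.
Proof.
move=> t s u /tens_eqvP h1 /tens_eqvP h2.
by apply/tens_eqvP => W f; rewrite h1 h2.
Qed.

Canonical tens_eqv_equiv :=
  EquivRel tens_eqv tens_eqv_refl tens_eqv_sym tens_eqv_trans.

Definition tens : Type := {eq_quot tens_eqv}.
HB.instance Definition _ := Choice.on tens.
HB.instance Definition _ := Quotient.on tens.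

Local Notation cls := (\pi_tens)%qT.
Local Notation rep := (@repr _ tens).

Definition opp_seq s := [seq (- p.1, p.2) | p <- s].
Definition scale_seq (a : k) s := [seq (a *: p.1, p.2) | p <- s].

Lemma clsP s t : reflect (cls s = cls t) (tens_eqv s t).
Proof. by apply: (iffP idP) => [h|/eqmodP //]; apply/eqmodP. Qed.

Lemma clsE s t : (forall (W : lmodType k) (f : {bilinear U -> V -> W}),
  fsum f s = fsum f t) -> cls s = cls t.
Proof. by move=> h; apply/clsP/tens_eqvP. Qed.

Lemma fsum_rep s (W : lmodType k) (f : {bilinear U -> V -> W}) :
  fsum f (rep (cls s)) = fsum f s.
Proof.
have /clsP/tens_eqvP h : cls (rep (cls s)) = cls s by rewrite reprK.
exact: h.
Qed.

Lemma fsum_cat (W : zmodType) (f : U -> V -> W) s t :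
  fsum f (s ++ t) = fsum f s + fsum f t.
Proof. by rewrite /fsum big_cat. Qed.

Lemma fsum_opp (W : lmodType k) (f : {bilinear U -> V -> W}) s :
  fsum f (opp_seq s) = - fsum f s.
Proof.
by rewrite /fsum big_map -sumrN; apply: eq_bigr => p _ /=; rewrite linearNl.
Qed.

Lemma fsum_scale (W : lmodType k) (f : {bilinear U -> V -> W}) a s :
  fsum f (scale_seq a s) = a *: fsum f s.
Proof.
by rewrite /fsum big_map scaler_sumr; apply: eq_bigr => p _ /=;
  rewrite linearZl_LR.
Qed.

Definition tens_zero : tens := cls [::].
Definition tens_add (x y : tens) : tens := cls (rep x ++ rep y).
Definition tens_opp (x : tens) : tens := cls (opp_seq (rep x)).
Definition tens_scale (a : k) (x : tens) : tens := cls (scale_seq a (rep x)).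

Lemma tens_addA : associative tens_add.
Proof. by move=> x y z; apply: clsE => W f; rewrite !(fsum_cat, fsum_rep) addrA. Qed.

Lemma tens_addC : commutative tens_add.
Proof. by move=> x y; apply: clsE => W f; rewrite !fsum_cat addrC. Qed.

Lemma tens_add0 : left_id tens_zero tens_add.
Proof.
move=> x; rewrite -[RHS]reprK; apply: clsE => W f.
by rewrite fsum_cat fsum_rep /fsum big_nil add0r.
Qed.

Lemma tens_addN : left_inverse tens_zero tens_opp tens_add.
Proof.
move=> x; apply: clsE => W f.
by rewrite fsum_cat fsum_rep fsum_opp addNr /fsum big_nil.
Qed.

HB.instance Definition _ :=
  GRing.isZmodule.Build tens tens_addA tens_addC tens_add0 tens_addN.

Lemma tens_scaleA a b x : tens_scale a (tens_scale b x) = tens_scale (a * b) x.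
Proof. by apply: clsE => W f; rewrite !(fsum_scale, fsum_rep) scalerA. Qed.

Lemma tens_scale1 : left_id 1 tens_scale.
Proof.
move=> x; rewrite -[RHS]reprK; apply: clsE => W f.
by rewrite fsum_scale scale1r.
Qed.

Lemma tens_scaleDr : right_distributive tens_scale +%R.
Proof.
move=> a x y; apply: clsE => W f.
by rewrite !(fsum_scale, fsum_rep, fsum_cat) scalerDr.
Qed.

Lemma tens_scaleDl x : {morph tens_scale^~ x : a b / a + b}.
Proof.
move=> a b; apply: clsE => W f.
by rewrite !(fsum_scale, fsum_rep, fsum_cat) scalerDl.
Qed.

HB.instance Definition _ := GRing.Zmodule_isLmodule.Build k tens
  tens_scaleA tens_scale1 tens_scaleDr tens_scaleDl.

Definition pure (u : U) (v : V) : tens := cls [:: (u, v)].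

(* The map U ⊗ V -> W induced by f : U -> V -> W.  It is computed on a chosen *)
(* representative and is meaningful only for f bilinear; all uses below are   *)
(* of this kind.                                                              *)
Definition tsum (W : zmodType) (f : U -> V -> W) (t : tens) : W :=
  fsum f (rep t).

Lemma tsum_pure (W : lmodType k) (f : {bilinear U -> V -> W}) u v :
  tsum f (pure u v) = f u v.
Proof. by rewrite /tsum fsum_rep /fsum big_seq1. Qed.

Lemma tsum_is_linear (W : lmodType k) (f : {bilinear U -> V -> W}) :
  linear (tsum f).
Proof.
move=> a x y; rewrite /tsum.
have -> : a *: x + y = tens_add (tens_scale a x) y by [].
by rewrite !(fsum_rep, fsum_cat, fsum_scale).
Qed.

Lemma pure_is_bilinear : bilinear_for *:%R *:%R pure.
Proof.
have addE a (x y : tens) : a *: x + y = tens_add (tens_scale a x) y by [].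
split=> [v a u u' | u a v v']; rewrite addE; apply: clsE => W f;
  rewrite fsum_cat fsum_rep fsum_scale !fsum_rep /fsum !big_seq1 /=.
- by rewrite linearDl linearZl_LR.
- by rewrite linearDr linearZr_LR.
Qed.

HB.instance Definition _ := bilinear_isBilinear.Build k U V tens *:%R *:%R
  pure pure_is_bilinear.

Lemma tens_spanned (t : tens) : exists s, t = \sum_(p <- s) pure p.1 p.2.
Proof.
exists (rep t); rewrite -[LHS]reprK.
elim: (rep t) => [|p s IH]; first by rewrite big_nil.
rewrite big_cons -IH [RHS]/(tens_add _ _); apply: clsE => W f.
by rewrite -cat1s !fsum_cat !fsum_rep; case: p.
Qed.

Lemma tens_ext (W : lmodType k) (f g : {linear tens -> W}) :
  (forall u v, f (pure u v) = g (pure u v)) -> f =1 g.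
Proof.
move=> h t; have [s ->] := tens_spanned t.
by rewrite !linear_sum; apply: eq_bigr => p _.
Qed.

End Tensor.

Notation "U ⊗ V" := (tens U V) (at level 40, left associativity) : type_scope.
Notation "u ⊗ v" := (pure u v) (at level 40, left associativity) : ring_scope.

(* Sweedler notation: if t = \sum u_i ⊗ v_i then                              *)
(* \sw_(u, v <- t) E u v = \sum E u_i v_i.                                    *)
Notation "\sw_ ( u , v <- t ) E" := (tsum (fun u v => E) t)
  (at level 41, u name, v name, t at level 70, E at level 41,
   format "\sw_ ( u ,  v  <-  t )  E") : ring_scope.

Definition trilinear (k : fieldType) (U V W X : lmodType k)
    (f : U -> V -> W -> X) : Prop :=
  [/\ forall v w, linear (fun u => f u v w),
      forall u w, linear (fun v => f u v w) &
      forall u v, linear (f u v)].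

Record hopf_algebra (k : fieldType) (H : algType k) := HopfAlgebra {
  comul : {linear H -> (H ⊗ H)%type};
  counit : {lrmorphism H -> k^o};
  antipode : {linear H -> H};
  comul_coassoc : forall h,
    \sw_(h1, h2 <- comul h) \sw_(h11, h12 <- comul h1) (h11 ⊗ (h12 ⊗ h2)) =
    \sw_(h1, h2 <- comul h) \sw_(h21, h22 <- comul h2) (h1 ⊗ (h21 ⊗ h22));
  comul_counitl : forall h, \sw_(h1, h2 <- comul h) (counit h1 *: h2) = h;
  comul_counitr : forall h, \sw_(h1, h2 <- comul h) (counit h2 *: h1) = h;
  comul1 : comul 1 = 1 ⊗ 1;
  comulM : forall g h,
    comul (g * h) = \sw_(g1, g2 <- comul g) \sw_(h1, h2 <- comul h)
                      ((g1 * h1) ⊗ (g2 * h2));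
  antipodel : forall h,
    \sw_(h1, h2 <- comul h) (antipode h1 * h2) = counit h *: 1;
  antipoder : forall h,
    \sw_(h1, h2 <- comul h) (h1 * antipode h2) = counit h *: 1
}.

Section Structures.
Variables (k : fieldType) (H : algType k) (hopf : hopf_algebra H).

Record is_comodule (M : lmodType k) (rho : M -> M ⊗ H) : Prop := {
  coact_linear : linear rho;
  coact_coassoc : forall m,
    \sw_(m0, m1 <- rho m) \sw_(m00, m01 <- rho m0) (m00 ⊗ (m01 ⊗ m1)) =
    \sw_(m0, m1 <- rho m) \sw_(h1, h2 <- comul hopf m1) (m0 ⊗ (h1 ⊗ h2));
  coact_counit : forall m, \sw_(m0, m1 <- rho m) (counit hopf m1 *: m0) = m
}.

Definition colinear (M N : lmodType k) (rhoM : M -> M ⊗ H) (rhoN : N -> N ⊗ H)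
    (f : M -> N) : Prop :=
  linear f /\ forall m, rhoN (f m) = \sw_(m0, m1 <- rhoM m) (f m0 ⊗ m1).

Definition coinvariants (M : lmodType k) (rho : M -> M ⊗ H) : set M :=
  [set m | rho m = m ⊗ 1].

(* rho I is contained in the image of I ⊗ H. *)
Definition subcomodule (M : lmodType k) (rho : M -> M ⊗ H) (I : set M) : Prop :=
  forall m, I m -> exists s : seq (M * H),
    (forall p, p \in s -> I p.1) /\ rho m = \sum_(p <- s) (p.1 ⊗ p.2).

Variable A : comAlgType k.

Section ThreeLie.
Variable br : A -> A -> A -> A.
Local Notation "{[ x , y , z ]}" := (br x y z).

Record is_3lie : Prop := {
  br_trilinear : trilinear br;
  br_skew12 : forall x y z, {[x, y, z]} = - {[y, x, z]};
  br_skew23 : forall x y z, {[x, y, z]} = - {[x, z, y]};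
  br_jacobi : forall x y z u v,
    {[{[x, y, z]}, u, v]} =
      {[{[x, u, v]}, y, z]} + {[{[y, u, v]}, z, x]} + {[{[z, u, v]}, x, y]}
}.

Record is_poisson_3lie : Prop := {
  poisson_3lie :> is_3lie;
  br_leibniz : forall x y u v,
    {[x, y, u * v]} = u * {[x, y, v]} + {[x, y, u]} * v
}.

Variables (M : lmodType k) (act : A -> M -> M) (dia : A -> A -> M -> M).

Record is_module : Prop := {
  act_linearl : forall m, linear (act^~ m);
  act_linearr : forall a, linear (act a);
  act1 : forall m, act 1 m = m;
  actM : forall a b m, act (a * b) m = act a (act b m)
}.

Record is_3lie_module : Prop := {
  dia_trilinear : trilinear dia;
  dia_skew : forall x y m, dia x y m = - dia y x m;
  dia_comm : forall x y u v m,
    dia x y (dia u v m) - dia u v (dia x y m) =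
      dia {[x, y, u]} v m + dia u {[x, y, v]} m;
  dia_br : forall x y u v m,
    dia {[x, y, u]} v m =
      dia y u (dia x v m) - dia x u (dia y v m) + dia x y (dia u v m)
}.

Record is_poisson_3lie_module : Prop := {
  poisson_module : is_module;
  poisson_3lie_module : is_3lie_module;
  dia_mul : forall x y z m,
    dia (x * y) z m = act x (dia y z m) + act y (dia x z m);
  dia_act : forall x y z m,
    dia x y (act z m) = act {[x, y, z]} m + act z (dia x y m)
}.

End ThreeLie.

Record is_comodule_algebra (rho : A -> A ⊗ H) : Prop := {
  comodule_algebra_comodule : is_comodule rho;
  coact1 : rho 1 = 1 ⊗ 1;
  coactM : forall a b,
    rho (a * b) = \sw_(a0, a1 <- rho a) \sw_(b0, b1 <- rho b)
                    ((a0 * b0) ⊗ (a1 * b1))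
}.

Record is_comodule_poisson_3lie (br : A -> A -> A -> A) (rho : A -> A ⊗ H)
    : Prop := {
  comodule_poisson : is_poisson_3lie br;
  comodule_poisson_algebra : is_comodule_algebra rho;
  coact_br : forall x y z,
    rho (br x y z) =
      \sw_(x0, x1 <- rho x) \sw_(y0, y1 <- rho y) \sw_(z0, z1 <- rho z)
        (br x0 y0 z0 ⊗ (x1 * y1 * z1))
}.

Record is_poisson_3lie_hopf_module (br : A -> A -> A -> A)
    (rhoA : A -> A ⊗ H) (M : lmodType k) (act : A -> M -> M)
    (dia : A -> A -> M -> M) (rhoM : M -> M ⊗ H) : Prop := {
  hopf_module_poisson : is_poisson_3lie_module br act dia;
  hopf_module_comodule : is_comodule rhoM;
  coact_act : forall a m,
    rhoM (act a m) = \sw_(a0, a1 <- rhoA a) \sw_(m0, m1 <- rhoM m)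
                       (act a0 m0 ⊗ (a1 * m1));
  coact_dia : forall x y m,
    rhoM (dia x y m) =
      \sw_(x0, x1 <- rhoA x) \sw_(y0, y1 <- rhoA y) \sw_(m0, m1 <- rhoM m)
        (dia x0 y0 m0 ⊗ (x1 * y1 * m1))
}.

Definition lie_invariants (M : lmodType k) (dia : A -> A -> M -> M) : set M :=
  [set m | forall x y, dia x y m = 0].

Definition center_3lie (br : A -> A -> A -> A) : set A :=
  [set b | forall x y, br b x y = 0].

(* Closure under scalars of k follows from absorption of A, as A is unital. *)
Record is_poisson_3lie_H_ideal (br : A -> A -> A -> A) (rho : A -> A ⊗ H)
    (I : set A) : Prop := {
  ideal0 : I 0;
  idealD : forall x y, I x -> I y -> I (x + y);
  idealM : forall a x, I x -> I (a * x);
  ideal_br : forall x a b, I x -> I (br x a b);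
  ideal_subcomodule : subcomodule rho I
}.

(* A <> 0 is part of the type comAlgType. *)
Definition poisson_H_simple (br : A -> A -> A -> A) (rho : A -> A ⊗ H) : Prop :=
  forall I : set A, is_poisson_3lie_H_ideal br rho I ->
    I = [set 0] \/ I = [set: A].

(* p_M; the argument Sinv is the inverse of the antipode. *)
Definition p_map (Sinv : H -> H) (phi : H -> A) (M : lmodType k)
    (act : A -> M -> M) (rho : M -> M ⊗ H) (m : M) : M :=
  \sw_(m0, m1 <- rho m) act (phi (Sinv m1)) m0.

Definition dia' (Sinv : H -> H) (phi : H -> A) (M : lmodType k)
    (act : A -> M -> M) (dia : A -> A -> M -> M) (rho : M -> M ⊗ H)
    (x y : A) (m : M) : M :=
  p_map Sinv phi act rho (dia x y m).

(* B is a basis of V over the scalars K, where K is a subring of A and V an   *)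
(* additive subgroup of M stable under K; K = A and V = M gives the notion    *)
(* of a basis of the A-module M.                                              *)
Record is_basis (M : lmodType k) (act : A -> M -> M) (K : set A)
    (V B : set M) : Prop := {
  basis_sub : B `<=` V;
  basis_span : forall v, V v -> exists (s : seq M) (c : M -> A),
    [/\ forall b, b \in s -> B b,
        forall b, b \in s -> K (c b) &
        v = \sum_(b <- s) act (c b) b];
  basis_free : forall (s : seq M) (c : M -> A), uniq s ->
    (forall b, b \in s -> B b) -> (forall b, b \in s -> K (c b)) ->
    \sum_(b <- s) act (c b) b = 0 -> forall b, b \in s -> c b = 0
}.

End Structures.

(* Main.v *)
Require Import Defs.
From HB Require Import structures.
From mathcomp Require Import all_boot all_algebra.
From mathcomp Require Import boolp classical_sets functions cardinality.

(* The map p(m) = φ(S^-1(m_1)) m_0 takes its values in M^coH, and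
   m = φ(m_1) p(m_0).  As ρ((x, y) ⋄ m) = (x_0, y_0) ⋄ m ⊗ x_1 y_1 for m
   coinvariant, triviality of ⋄' on M^coH forces ⋄ itself to vanish there, so
   that M^AcoH = M^coH, and likewise A^AcoH = A^coH =: K, a field by
   H-simplicity.  A K-basis B of M^coH generates the A-module M because
   m = φ(m_1) p(m_0).  It is free over A: if c_b is the b-th coordinate with
   respect to B, the map m |-> φ(m_1) c_b(p(m_0)) sends a sum of terms a_b b to
   a_b.  Finally any two bases of a module over a nonzero commutative ring have
   the same cardinality. *)

Import GRing.Theory.
Local Open Scope ring_scope.
Local Open Scope classical_set_scope.
Local Open Scope card_scope.

Set Implicit Arguments.
Unset Strict Implicit.
Unset Printing Implicit Defensive.

(** * Sweedler sums *)

Section LinearMaps.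
Variables (k : fieldType) (U V : lmodType k).

Lemma lin_sum (f : U -> V) : linear f -> forall (I : Type) (r : seq I) F,
  f (\sum_(i <- r) F i) = \sum_(i <- r) f (F i).
Proof.
move=> fL I r F.
have f0 : f 0 = 0.
  by have := fL (-1) 0 0; rewrite !scaleN1r oppr0 addr0 addNr.
elim: r => [|i r IH]; first by rewrite !big_nil.
by rewrite !big_cons -IH -[F i]scale1r fL !scale1r.
Qed.

Lemma lin0 (f : U -> V) : linear f -> f 0 = 0.
Proof.
by move=> fL; have := lin_sum fL [::] (fun _ : U => 0); rewrite !big_nil.
Qed.

Lemma linD (f : U -> V) : linear f -> {morph f : x y / x + y}.
Proof. by move=> fL x y; rewrite -[x]scale1r fL !scale1r. Qed.

Lemma linZ (f : U -> V) : linear f -> forall a x, f (a *: x) = a *: f x.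
Proof. by move=> fL a x; rewrite -[a *: x]addr0 fL lin0 // addr0. Qed.

Lemma linN (f : U -> V) : linear f -> {morph f : x / - x}.
Proof. by move=> fL x; rewrite -scaleN1r linZ // scaleN1r. Qed.

End LinearMaps.

Section TensorMaps.
Variables (k : fieldType) (U V W X : lmodType k).

Lemma lin_comp (f : V -> W) (g : U -> V) :
  linear f -> linear g -> linear (fun x => f (g x)).
Proof. by move=> fL gL a x y; rewrite gL fL. Qed.

(** A plain function carries no canonical bilinear structure, so one is packed on the spot from the
    proof of bilinearity; this opens the universal property to Sweedler sums. *)
Lemma lin_tsum (F : U -> V -> W) :
  bilinear_for *:%R *:%R F -> linear (tsum F).
Proof.
move=> Fb; pose B := bilinear_isBilinear.Build k U V W *:%R *:%R F Fb.
pose G : {bilinear U -> V -> W} := HB.pack F B.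
exact: (tsum_is_linear G).
Qed.

Lemma tsum_pureE (F : U -> V -> W) :
  bilinear_for *:%R *:%R F -> forall u v, tsum F (u ⊗ v) = F u v.
Proof.
move=> Fb u v; pose B := bilinear_isBilinear.Build k U V W *:%R *:%R F Fb.
pose G : {bilinear U -> V -> W} := HB.pack F B.
exact: (tsum_pure G).
Qed.

(** The representative of [t] is chosen once, independently of [x], so linearity is checked term by
    term. *)
Lemma lin_tsum_param (F : X -> U -> V -> W) t :
  (forall u v, linear (fun x => F x u v)) -> linear (fun x => tsum (F x) t).
Proof.
move=> FL a x y; rewrite /tsum /fsum scaler_sumr -big_split /=.
by apply: eq_bigr => p _; rewrite FL.
Qed.

Lemma tsum_comp (f : W -> X) : linear f -> forall (F : U -> V -> W) t,
  f (tsum F t) = \sw_(u, v <- t) f (F u v).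
Proof. by move=> fL F t; rewrite /tsum /fsum (lin_sum fL). Qed.

Lemma purePl a (u u' : U) (v : V) :
  (a *: u + u') ⊗ v = a *: (u ⊗ v) + u' ⊗ v.
Proof. by rewrite linearDl linearZl_LR. Qed.

Lemma purePr a (u : U) (v v' : V) :
  u ⊗ (a *: v + v') = a *: (u ⊗ v) + u ⊗ v'.
Proof. by rewrite linearDr linearZr_LR. Qed.

End TensorMaps.

Section TensorId.
Variables (k : fieldType) (U V : lmodType k).

Lemma tsum_pure_id (t : U ⊗ V) : \sw_(u, v <- t) (u ⊗ v) = t.
Proof.
have [s ->] := tens_spanned t; rewrite (lin_sum (f := tsum _)); last first.
  by apply: lin_tsum; split=> [v|u] a x y; rewrite (purePl, purePr).
apply: eq_bigr => p _; rewrite tsum_pureE //.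
by split=> [v|u] a x y; rewrite (purePl, purePr).
Qed.

End TensorId.

Lemma eq_tsum (k : fieldType) (U V : lmodType k) (W : zmodType)
    (F G : U -> V -> W) t :
  (forall u v, F u v = G u v) -> tsum F t = tsum G t.
Proof. by move=> e; apply: eq_bigr => p _; exact: e. Qed.

Lemma tsum_eq0 (k : fieldType) (U V : lmodType k) (W : zmodType)
    (F : U -> V -> W) t :
  (forall u v, F u v = 0) -> tsum F t = 0.
Proof. by move=> e; apply: big1 => p _; exact: e. Qed.

Lemma tsum_exchange (k : fieldType) (U V U' V' : lmodType k) (W : zmodType)
    (F : U -> V -> U' -> V' -> W) t t' :
  \sw_(u, v <- t) \sw_(x, y <- t') F u v x y =
  \sw_(x, y <- t') \sw_(u, v <- t) F u v x y.
Proof. exact: exchange_big. Qed.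

Section Algebra.
Variables (k : fieldType) (R : algType k).

Lemma mulPl a (x y z : R) : (a *: x + y) * z = a *: (x * z) + y * z.
Proof. by rewrite mulrDl scalerAl. Qed.

Lemma mulPr a (x y z : R) : z * (a *: x + y) = a *: (z * x) + z * y.
Proof. by rewrite mulrDr scalerAr. Qed.

End Algebra.

Lemma mul_is_module (k : fieldType) (A : comAlgType k) :
  is_module (fun a b : A => a * b).
Proof.
split=> [m a x y|a b x y|m|a b m]; rewrite ?mulPl ?mulPr ?mul1r ?mulrA //.
Qed.

(** * Comodules and the antipode *)

Section Comodule.
Variables (k : fieldType) (H : algType k) (hopf : hopf_algebra H).
Local Notation Δ := (comul hopf).
Local Notation ε := (counit hopf).
Local Notation S := (antipode hopf).

(** Coassociativity is an identity in M ⊗ (H ⊗ H); the linear map induced by [F] carries it over to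
    [W]. *)
Lemma coassoc3 (M W : lmodType k) (rho : M -> M ⊗ H) (F : M -> H -> H -> W) m :
    is_comodule hopf rho -> trilinear F ->
  \sw_(m0, m1 <- rho m) \sw_(m00, m01 <- rho m0) F m00 m01 m1 =
  \sw_(m0, m1 <- rho m) \sw_(h1, h2 <- Δ m1) F m0 h1 h2.
Proof.
move=> [_ co _] [F1 F2 F3].
have Fb x : bilinear_for *:%R *:%R (F x) by split=> [v|u]; [exact: F2|exact: F3].
pose G x t := tsum (F x) t.
have Gb : bilinear_for *:%R *:%R G.
  split=> [t|x]; last exact: lin_tsum.
  by apply: lin_tsum_param => u v; exact: F1.
have GL := lin_tsum Gb.
have := congr1 (tsum G) (co m); rewrite !(tsum_comp GL).
under eq_tsum => u v do (rewrite (tsum_comp GL);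
  under eq_tsum => u' v' do rewrite (tsum_pureE Gb) /G (tsum_pureE (Fb _))).
move=> ->.
apply: eq_tsum => u v; rewrite (tsum_comp GL); apply: eq_tsum => u' v'.
by rewrite (tsum_pureE Gb) /G (tsum_pureE (Fb _)).
Qed.

Lemma comul_comodule : is_comodule hopf Δ.
Proof.
split; [exact: linearP|exact: comul_coassoc|exact: comul_counitr].
Qed.

Lemma tsum_counitr (M W : lmodType k) (rho : M -> M ⊗ H) (f : M -> W) m :
    is_comodule hopf rho -> linear f ->
  \sw_(m0, m1 <- rho m) (ε m1 *: f m0) = f m.
Proof.
move=> [_ _ e] fL; rewrite -[in RHS](e m) tsum_comp //.
by apply: eq_tsum => u v; rewrite linZ.
Qed.

Lemma antipode1 : S 1 = 1.
Proof.
have := antipodel hopf 1; rewrite comul1 tsum_pureE ?mulr1 ?rmorph1 ?scale1r //.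
by split=> [v|u] a x y /=; rewrite ?linearP (mulPl, mulPr).
Qed.

(* Insert h_2 S(h_3) and use S(g_1 h_1) g_2 h_2 = ε(gh). *)
Lemma antipodeM1 g h : \sw_(g1, g2 <- Δ g) (S (g1 * h) * g2) = ε g *: S h.
Proof.
have SL : linear S by exact: linearP.
have e0 h' : \sw_(g1, g2 <- Δ g) \sw_(h1, h2 <- Δ h')
    (S (g1 * h1) * (g2 * h2)) = (ε g * ε h') *: 1.
  have b : bilinear_for *:%R *:%R (fun x y : H => S x * y).
    by split=> [v|u] a x y /=; rewrite ?linearP (mulPl, mulPr).
  rewrite -rmorphM -antipodel comulM (tsum_comp (lin_tsum b)).
  apply: eq_tsum => u v; rewrite (tsum_comp (lin_tsum b)).
  by apply: eq_tsum => u' v'; rewrite tsum_pureE.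
have -> : \sw_(g1, g2 <- Δ g) (S (g1 * h) * g2) =
    \sw_(g1, g2 <- Δ g) \sw_(h1, h2 <- Δ h) \sw_(h21, h22 <- Δ h2)
      (S (g1 * h1) * g2 * (h21 * S h22)).
  apply: eq_tsum => u v.
  rewrite -(tsum_counitr (f := fun x => S (u * x) * v) _ comul_comodule);
    last first.
    by move=> a x y; rewrite mulPr linearP mulPl.
  apply: eq_tsum => x y; rewrite -tsum_comp ?antipoder -?scalerAr ?mulr1 //.
  by move=> a z z'; rewrite mulPr.
(* Regrouping by coassociativity brings S(g_1 h_1) g_2 h_2 together, to which [e0] applies after [h]
   is replaced by its first leg; what remains is ε(g) ε(h_1) S(h_2). *)
under eq_tsum => u v do
  (rewrite -(coassoc3 (F := fun a b c => S (u * a) * v * (b * S c)) _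
    comul_comodule); last by split=> b c a x y;
    rewrite ?linearP ?mulPr ?mulPl ?linearP ?mulPl ?mulPr).
rewrite tsum_exchange.
under eq_tsum => u v.
  have -> : \sw_(g1, g2 <- Δ g) \sw_(h1, h2 <- Δ u)
      (S (g1 * h1) * g2 * (h2 * S v)) =
     (ε g *: (ε u *: S v)).
    transitivity ((\sw_(g1, g2 <- Δ g) \sw_(h1, h2 <- Δ u)
       (S (g1 * h1) * (g2 * h2))) * S v).
      rewrite (tsum_comp (f := fun x => x * S v)); last first.
        by move=> a x y; rewrite mulPl.
      apply: eq_tsum => x y.
      rewrite (tsum_comp (f := fun x => x * S v)); last first.
        by move=> a ? ?; rewrite mulPl.
      by apply: eq_tsum => z z'; rewrite !mulrA.
    by rewrite e0 -scalerAl mul1r scalerA.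
  over.
rewrite -tsum_comp; last by move=> a x y; rewrite scalerDr !scalerA mulrC.
congr (_ *: _); rewrite -[in RHS](comul_counitl hopf h) tsum_comp //.
by apply: eq_tsum => x y; rewrite linearZ.
Qed.

(** Write S(gh) as S(g_1 h) g_2 S(g_3); by [antipodeM1] the first two factors collapse to ε(g_1)
    S(h). *)
Lemma antipodeM g h : S (g * h) = S h * S g.
Proof.
rewrite -(tsum_counitr (f := fun x => S (x * h)) _ comul_comodule); last first.
  by move=> a x y; rewrite mulPl linearP.
transitivity (\sw_(g1, g2 <- Δ g) \sw_(g21, g22 <- Δ g2)
    (S (g1 * h) * g21 * S g22)).
  apply: eq_tsum => u v; rewrite -[S (u * h) in LHS]mulr1 scalerAr -antipoder.
  rewrite (tsum_comp (f := fun x => S (u * h) * x)); last first.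
    by move=> a x y; rewrite mulPr.
  by apply: eq_tsum => x y; rewrite mulrA.
rewrite -(coassoc3 (F := fun a b c => S (a * h) * b * S c) _ comul_comodule);
  last by split=> b c a x y; rewrite ?(mulPr, mulPl, linearP).
transitivity (\sw_(g1, g2 <- Δ g) (S h * (ε g1 *: S g2))).
  apply: eq_tsum => u v; rewrite -scalerAr scalerAl -antipodeM1.
  by rewrite [RHS](tsum_comp (f := fun x => x * S v)) // => a x y; rewrite mulPl.
rewrite -[in RHS](comul_counitl hopf g) tsum_comp; last by exact: linearP.
rewrite (tsum_comp (f := fun x => S h * x)); last by move=> a x y; rewrite mulPr.
by apply: eq_tsum => x y; rewrite linearZ.
Qed.

Variable Sinv : H -> H.
Hypotheses (SK : cancel S Sinv) (SinvK : cancel Sinv S).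

Lemma antipode_inv_linear : linear Sinv.
Proof. by move=> a x y; apply: (can_inj SK); rewrite linearP !SinvK. Qed.

(** Under the antipode, which is injective and reverses products, this becomes the axiom S(h_1) h_2
    = ε(h) 1. *)
Lemma antipode_invl h : \sw_(h1, h2 <- Δ h) (Sinv h2 * h1) = ε h *: 1.
Proof.
apply: (can_inj SK); rewrite linearZ_LR antipode1 -antipodel tsum_comp;
  last exact: linearP.
by apply: eq_tsum => x y; rewrite antipodeM SinvK.
Qed.

Lemma antipode_invr h : \sw_(h1, h2 <- Δ h) (h2 * Sinv h1) = ε h *: 1.
Proof.
apply: (can_inj SK); rewrite linearZ_LR antipode1 -antipoder tsum_comp;
  last exact: linearP.
by apply: eq_tsum => x y; rewrite antipodeM SinvK.
Qed.

End Comodule.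

(** * Coordinates in a free module *)

Section Coordinates.
Variables (k : fieldType) (A : comAlgType k) (M : lmodType k).
Variables (act : A -> M -> M) (K : set A).
Hypothesis act_module : is_module act.
Hypotheses (K0 : K 0) (K1 : K 1).
Hypothesis Klin : forall (a : k) x y, K x -> K y -> K (a *: x + y).
Hypothesis KM : forall x y, K x -> K y -> K (x * y).
Variable B : set M.

Let actl : forall m, linear (act^~ m) := act_linearl act_module.
Let actr : forall a, linear (act a) := act_linearr act_module.

(** Coordinates are total functions supported on a duplicate-free list, so that families with
    different supports can be added and compared pointwise. *)
Definition coords (v : M) (c : M -> A) : Prop := exists s : seq M,
  [/\ uniq s, forall b, b \in s -> B b, forall b, b \notin s -> c b = 0,
      forall b, K (c b) & v = \sum_(b <- s) act (c b) b].

Lemma act0m m : act 0 m = 0.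
Proof. exact: lin0 (actl m). Qed.

Lemma big_support (s t : seq M) (c : M -> A) :
    uniq s -> uniq t -> {subset s <= t} -> (forall b, b \notin s -> c b = 0) ->
  \sum_(b <- s) act (c b) b = \sum_(b <- t) act (c b) b.
Proof.
move=> us ut st c0; rewrite (bigID (mem s)) /= [X in _ + X]big1; last first.
  by move=> b bs; rewrite c0 // act0m.
rewrite addr0 (bigID (mem s) (r := t)) /= [X in _ = _ + X]big1; last first.
  by move=> b bs; rewrite c0 // act0m.
rewrite addr0 -[LHS]big_filter -[RHS]big_filter; apply: perm_big.
apply: uniq_perm; rewrite ?filter_uniq // => b; rewrite !mem_filter.
by case bs: (b \in s) => //=; rewrite st.
Qed.

Lemma coords0 : coords 0 (fun=> 0).
Proof. by exists [::]; rewrite big_nil. Qed.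

Lemma coords_lin a v w c d : coords v c -> coords w d ->
  coords (a *: v + w) (fun b => a *: c b + d b).
Proof.
move=> [s [us sB sc sK ->]] [t [ut tB tc tK ->]].
have uu := undup_uniq (s ++ t).
exists (undup (s ++ t)); split=> // [b|b|b|].
- by rewrite mem_undup mem_cat => /orP[/sB|/tB].
- rewrite mem_undup mem_cat negb_or => /andP[/sc-> /tc->].
  by rewrite scaler0 addr0.
- exact: Klin.
rewrite (big_support us uu) //; last first.
  by move=> b bs; rewrite mem_undup mem_cat bs.
rewrite (big_support ut uu) //; last first.
  by move=> b bs; rewrite mem_undup mem_cat bs orbT.
rewrite scaler_sumr -big_split /=; apply: eq_bigr => b _.
by rewrite actl.
Qed.

Lemma coordsM a v c : K a -> coords v c -> coords (act a v) (fun b => a * c b).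
Proof.
move=> Ka [s [us sB sc sK ->]]; exists s; split=> // [b /sc->|b|].
- by rewrite mulr0.
- exact: KM.
by rewrite (lin_sum (actr a)); apply: eq_bigr => b _; rewrite (actM act_module).
Qed.

Lemma coords_sum (I : Type) (r : seq I) (v : I -> M) (c : I -> M -> A) :
    (forall i, coords (v i) (c i)) ->
  coords (\sum_(i <- r) v i) (fun b => \sum_(i <- r) c i b).
Proof.
move=> vc; elim: r => [|i r IH].
  have -> : (fun b => \sum_(i <- [::]) c i b) = (fun=> 0).
    by apply/funext => b; rewrite big_nil.
  by rewrite big_nil; exact: coords0.
have -> : (fun b => \sum_(j <- i :: r) c j b) =
    (fun b => 1 *: c i b + \sum_(j <- r) c j b).
  by apply/funext => b; rewrite big_cons scale1r.
by rewrite big_cons -[v i]scale1r; exact: coords_lin.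
Qed.

Lemma coords_mem b : B b -> coords b (fun x => (x == b)%:R).
Proof.
move=> Bb; exists [:: b]; split=> // [x|x|x|].
- by rewrite inE => /eqP->.
- by rewrite inE => /negPf->.
- by case: eqP.
by rewrite big_seq1 eqxx (act1 act_module).
Qed.

Lemma coords_unique V v c d :
  is_basis act K V B -> coords v c -> coords v d -> c =1 d.
Proof.
move=> [_ _ free] vc vd b; apply/eqP; rewrite -subr_eq0; apply/eqP.
have := coords_lin (-1) vd vc; rewrite scaleN1r addNr => -[s [us sB sc sK s0]].
have e x : - d x + c x = c x - d x by rewrite addrC.
have [bs|/sc] := boolP (b \in s); last by rewrite scaleN1r e.
by have /(_ b bs) := free s _ us sB (fun b _ => sK b) (esym s0); rewrite scaleN1r e.
Qed.

Lemma coords_exists V v : is_basis act K V B -> V v -> exists c, coords v c.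
Proof.
move=> [_ span _] /span[s [c [sB sK ->]]].
(* The spanning list may repeat vectors; the multiplicity of [b] is moved into its coefficient. *)
exists (fun b => c b *+ count_mem b s), (undup s).
have KMn x n : K x -> K (x *+ n).
  move=> Kx; elim: n => [|n IH]; first by rewrite mulr0n.
  by rewrite mulrS -[x in x + _]scale1r; exact: Klin.
split=> [|b|b|b|].
- exact: undup_uniq.
- by rewrite mem_undup; exact: sB.
- by rewrite mem_undup => /count_memPn->.
- have [/sK Kb|/count_memPn->//] := boolP (b \in s); exact: KMn.
rewrite -[LHS]big_undup_iterop_count; apply: eq_bigr => b _.
rewrite Monoid.iteropE -[LHS]/(iter _ _ _).
elim: (count_mem b s) => [|n IH]; first by rewrite mulr0n act0m.
by rewrite iterS IH mulrS (linD (actl b)).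
Qed.

End Coordinates.

(** * Hopf modules *)

Section HopfModule.
Variables (k : fieldType) (H : algType k) (hopf : hopf_algebra H).
Local Notation Δ := (comul hopf).
Local Notation ε := (counit hopf).
Local Notation S := (antipode hopf).
Variable Sinv : H -> H.
Hypotheses (SK : cancel S Sinv) (SinvK : cancel Sinv S).
Variables (A : comAlgType k) (rhoA : A -> A ⊗ H).
Hypothesis hA : is_comodule_algebra hopf rhoA.
Variable phi : {lrmorphism H -> A}.
Hypothesis phi_colinear : colinear Δ rhoA phi.
Variables (M : lmodType k) (act : A -> M -> M) (rhoM : M -> M ⊗ H).
Hypotheses (actM_module : is_module act) (rhoM_comodule : is_comodule hopf rhoM).
Hypothesis rho_act : forall a m,
  rhoM (act a m) = \sw_(a0, a1 <- rhoA a) \sw_(m0, m1 <- rhoM m)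
                     (act a0 m0 ⊗ (a1 * m1)).
Local Notation p := (p_map Sinv phi act rhoM).
Local Notation pA := (p_map Sinv phi *%R rhoA).

Let rhoL : linear rhoM := coact_linear rhoM_comodule.
Let rhoAL : linear rhoA := coact_linear (comodule_algebra_comodule hA).
Let phiL : linear phi := phi_colinear.1.
Let psiL : linear (fun h => phi (Sinv h)) :=
  lin_comp phiL (antipode_inv_linear SK SinvK).
Let actl : forall m, linear (act^~ m) := act_linearl actM_module.
Let actr : forall a, linear (act a) := act_linearr actM_module.
Let actA : forall a b m, act (a * b) m = act a (act b m) := actM actM_module.

(** Apply [phi] to S^-1(h_2) h_1 = ε(h) 1; commutativity of A exchanges the factors. *)
Lemma phi_Sinvr h : \sw_(h1, h2 <- Δ h) (phi h1 * phi (Sinv h2)) = ε h *: 1.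
Proof.
rewrite -(rmorph1 phi) -(linZ phiL) -(antipode_invl SK SinvK) (tsum_comp phiL).
by apply: eq_tsum => x y; rewrite mulrC rmorphM.
Qed.

Lemma phi_Sinvl h : \sw_(h1, h2 <- Δ h) (phi (Sinv h1) * phi h2) = ε h *: 1.
Proof.
rewrite -(rmorph1 phi) -(linZ phiL) -(antipode_invr SK SinvK) (tsum_comp phiL).
by apply: eq_tsum => x y; rewrite mulrC rmorphM.
Qed.

Lemma p_bilinear :
  bilinear_for *:%R *:%R (fun (m : M) (h : H) => act (phi (Sinv h)) m).
Proof. by split=> [h|m] a x y; rewrite ?psiL (actl, actr). Qed.

Lemma p_linear : linear p.
Proof. exact: lin_comp (lin_tsum p_bilinear) rhoL. Qed.

(** By coassociativity the sum equals φ(S^-1(m_1)) φ(m_2) m_0, where the coefficient reduces to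
    ε(m_1). *)
Lemma act_phi_p m : \sw_(m0, m1 <- rhoM m) act (phi m1) (p m0) = m.
Proof.
transitivity (\sw_(m0, m1 <- rhoM m) \sw_(m00, m01 <- rhoM m0)
    act (phi (Sinv m01)) (act (phi m1) m00)).
  apply: eq_tsum => x y; rewrite tsum_comp; last exact: actr.
  by apply: eq_tsum => u v; rewrite -!actA mulrC.
rewrite (coassoc3 (F := fun m g h => act (phi (Sinv g)) (act (phi h) m)) _
  rhoM_comodule);
  last first.
  by split=> u v a x y; rewrite ?psiL ?phiL ?(actl, actr) // (actl, actr).
rewrite -[RHS](tsum_counitr (f := id) m rhoM_comodule) //.
apply: eq_tsum => x h.
transitivity (act (\sw_(h1, h2 <- Δ h) (phi (Sinv h1) * phi h2)) x).
  rewrite (tsum_comp (actl x)).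
  by apply: eq_tsum => u v; rewrite actA.
by rewrite phi_Sinvl (linZ (actl x)) (act1 actM_module).
Qed.

Lemma rho_act_coinv a v : coinvariants rhoM v ->
  rhoM (act a v) = \sw_(a0, a1 <- rhoA a) (act a0 v ⊗ a1).
Proof.
move=> hv; rewrite rho_act hv; apply: eq_tsum => x h.
rewrite tsum_pureE ?mulr1 //.
by split=> [u|u] b y z; rewrite ?actr ?mulPr ?purePl ?purePr.
Qed.

(** For coinvariant [v] the coaction of av comes from [a] alone. *)
Lemma p_act_coinv a v : coinvariants rhoM v -> p (act a v) = act (pA a) v.
Proof.
move=> hv; rewrite /p_map rho_act_coinv // (tsum_comp (lin_tsum p_bilinear)).
rewrite (tsum_comp (actl v)); apply: eq_tsum => x h.
by rewrite (tsum_pureE p_bilinear) actA.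
Qed.

(* As m = φ(m_1) p(m_0), the coaction of m is ρ(φ(m_1)) (p(m_0) ⊗ 1). *)
Lemma rho_phi_p m : rhoM m =
  \sw_(m0, m1 <- rhoM m) \sw_(h1, h2 <- Δ m1) (act (phi h1) (p m0) ⊗ h2).
Proof.
rewrite -(coassoc3 (F := fun m g h => act (phi g) (p m) ⊗ h) _ rhoM_comodule);
  last first.
  by split=> u v a x y; rewrite ?p_linear ?phiL ?(actl, actr) ?purePl ?purePr.
rewrite -[LHS]tsum_pure_id; apply: eq_tsum => x h.
rewrite -[in LHS](act_phi_p x) (tsum_comp (f := fun x => x ⊗ h)) //.
by move=> a y z; rewrite purePl.
Qed.

(* Together with [rho_phi_p], this computes ρ(p(m)) as
   ρ(φ(S^-1(m_2)) φ(m_1)) (p(m_0) ⊗ 1), without the formula for Δ(S^-1(h)). *)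
Lemma p_coinv m : coinvariants rhoM (p m).
Proof.
(* [G a t] is the product ρ(a) t for the action of A ⊗ H on M ⊗ H, so the Hopf module axiom reads
   ρ(an) = G a (ρ(n)). *)
pose G a t := \sw_(a0, a1 <- rhoA a) \sw_(m0, m1 <- t) (act a0 m0 ⊗ (a1 * m1)).
have actb (a : A) (g : H) :
    bilinear_for *:%R *:%R (fun (m : M) (h : H) => act a m ⊗ (g * h)).
  by split=> u b x y; rewrite ?mulPr ?actr ?purePl ?purePr.
have Gb (t : M ⊗ H) : bilinear_for *:%R *:%R
   (fun (a : A) (g : H) => \sw_(m0, m1 <- t) (act a m0 ⊗ (g * m1))).
  split=> u; apply: lin_tsum_param => x h b y z.
    by rewrite actl purePl.
  by rewrite mulPl purePr.
have Gl t : linear (G^~ t) by apply: lin_comp (lin_tsum (Gb t)) rhoAL.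
have Gr a : linear (G a).
  by apply: lin_tsum_param => x h; apply: lin_tsum.
have Grho a n : rhoM (act a n) = G a (rhoM n) by rewrite rho_act.
have G1 n : G 1 (n ⊗ 1) = n ⊗ 1.
  by rewrite /G (coact1 hA) (tsum_pureE (Gb _)) (tsum_pureE (actb _ _))
     (act1 actM_module) mulr1.
(* Colinearity of [phi] turns φ(h_1) ⊗ h_2 into ρ(φ(h)), which merges with ρ(a) by multiplicativity
   of ρ. *)
have Gphi a h n : G a (\sw_(h1, h2 <- Δ h) (act (phi h1) n ⊗ h2)) =
    G (a * phi h) (n ⊗ 1).
  have nb : bilinear_for *:%R *:%R (fun (b : A) (g : H) => act b n ⊗ g).
    by split=> u b x y; rewrite ?actl ?purePl ?purePr.
  have Gn b : G b (n ⊗ 1) = \sw_(b0, b1 <- rhoA b) (act b0 n ⊗ b1).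
    by apply: eq_tsum => x g; rewrite (tsum_pureE (actb _ _)) mulr1.
  rewrite Gn (coactM hA) phi_colinear.2 (tsum_comp (lin_tsum nb)).
  apply: eq_tsum => a0 a1.
  rewrite (tsum_comp (lin_tsum (actb _ _))) (tsum_comp (lin_tsum nb)).
  under [RHS]eq_tsum => b g do rewrite (tsum_pureE nb).
  have cb : bilinear_for *:%R *:%R
      (fun (b : A) (g : H) => act (a0 * b) n ⊗ (a1 * g)).
    by split=> u b x y; rewrite mulPr ?actl ?purePl ?purePr.
  rewrite (tsum_comp (lin_tsum cb)); apply: eq_tsum => h1 h2.
  by rewrite (tsum_pureE (actb _ _)) (tsum_pureE cb) actA.
rewrite /coinvariants /= /p_map (tsum_comp rhoL).
transitivity (\sw_(m0, m1 <- rhoM m) \sw_(m00, m01 <- rhoM m0)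
    G (phi (Sinv m1) * phi m01) (p m00 ⊗ 1)).
  apply: eq_tsum => x h; rewrite Grho [in LHS]rho_phi_p (tsum_comp (Gr _)).
  by apply: eq_tsum => y g; rewrite Gphi.
rewrite (coassoc3 (F := fun m g h => G (phi (Sinv h) * phi g) (p m ⊗ 1)) _
  rhoM_comodule); last first.
  by split=> u v a x y; rewrite ?p_linear ?phiL ?psiL ?mulPr ?mulPl ?purePl ?Gr ?Gl.
have pL1 : linear (fun x => p x ⊗ (1 : H)).
  by move=> a x y; rewrite p_linear purePl.
rewrite -[RHS](tsum_counitr m rhoM_comodule pL1); apply: eq_tsum => x h.
(* By linearity of [G] in its first argument, φ(S^-1(h_2)) φ(h_1) collapses to ε(h) 1, and [G 1]
   fixes p(m_0) ⊗ 1. *)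
rewrite -[in RHS]G1 -(linZ (Gl _)) -phi_Sinvr (tsum_comp (Gl _)).
by apply: eq_tsum => h1 h2; rewrite mulrC.
Qed.

(* n = (x, y) ⋄ m equals φ(n_1) p(n_0), where n_0 has the form
   (x_0, y_0) ⋄ m. *)
Lemma dia_coinv_eq0 (dia : A -> A -> M -> M) : trilinear dia ->
    (forall x y m, rhoM (dia x y m) =
      \sw_(x0, x1 <- rhoA x) \sw_(y0, y1 <- rhoA y) \sw_(m0, m1 <- rhoM m)
        (dia x0 y0 m0 ⊗ (x1 * y1 * m1))) ->
    (forall x y m, coinvariants rhoM m -> p (dia x y m) = 0) ->
  forall x y m, coinvariants rhoM m -> dia x y m = 0.
Proof.
move=> [_ _ dL] rhod pd x y m hm; rewrite -(act_phi_p (dia x y m)) rhod hm.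
have Fb : bilinear_for *:%R *:%R (fun (m : M) (h : H) => act (phi h) (p m)).
  by split=> u a v w; rewrite ?p_linear ?phiL (actl, actr).
rewrite (tsum_comp (lin_tsum Fb)); apply: tsum_eq0 => x0 x1.
rewrite (tsum_comp (lin_tsum Fb)); apply: tsum_eq0 => y0 y1.
rewrite tsum_pureE; last first.
  by split=> u a v w; rewrite ?mulPr ?dL ?purePl ?purePr.
by rewrite (tsum_pureE Fb) pd // (lin0 (actr _)).
Qed.

End HopfModule.

(** * The subalgebra of coinvariants of A *)

Section Coinvariants.
Variables (k : fieldType) (H : algType k) (hopf : hopf_algebra H).
Variables (A : comAlgType k) (rhoA : A -> A ⊗ H).
Hypothesis hA : is_comodule_algebra hopf rhoA.

Let rhoAL : linear rhoA := coact_linear (comodule_algebra_comodule hA).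

Lemma coinvM a b : coinvariants rhoA a -> coinvariants rhoA b ->
  coinvariants rhoA (a * b).
Proof.
move=> ha hb; rewrite /coinvariants /= (coactM hA) ha hb.
have b1 x y : bilinear_for *:%R *:%R
    (fun (b : A) (g : H) => (x * b) ⊗ (y * g)).
  by split=> u c v w; rewrite mulPr ?purePl ?purePr.
under eq_tsum => x y do rewrite (tsum_pureE (b1 _ _)).
rewrite tsum_pureE ?mulr1 //.
by split=> u c v w; rewrite mulPl ?purePl ?purePr.
Qed.

Lemma coinv0 : coinvariants rhoA 0.
Proof. by rewrite /coinvariants /= (lin0 rhoAL) linear0l. Qed.

Lemma coinv_lin (a : k) x y : coinvariants rhoA x -> coinvariants rhoA y ->
  coinvariants rhoA (a *: x + y).
Proof. by rewrite /coinvariants /= rhoAL purePl => -> ->. Qed.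

End Coinvariants.

(** * Lifting bases from the coinvariants to the whole module *)

Section Freeness.
Variables (k : fieldType) (H : algType k) (hopf : hopf_algebra H).
Local Notation Δ := (comul hopf).
Local Notation S := (antipode hopf).
Variable Sinv : H -> H.
Hypotheses (SK : cancel S Sinv) (SinvK : cancel Sinv S).
Variables (A : comAlgType k) (rhoA : A -> A ⊗ H).
Hypothesis hA : is_comodule_algebra hopf rhoA.
Variable phi : {lrmorphism H -> A}.
Hypothesis phi_colinear : colinear Δ rhoA phi.
Variables (M : lmodType k) (act : A -> M -> M) (rhoM : M -> M ⊗ H).
Hypotheses (actM_module : is_module act) (rhoM_comodule : is_comodule hopf rhoM).
Hypothesis rho_act : forall a m,
  rhoM (act a m) = \sw_(a0, a1 <- rhoA a) \sw_(m0, m1 <- rhoM m)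
                     (act a0 m0 ⊗ (a1 * m1)).
Local Notation p := (p_map Sinv phi act rhoM).
Local Notation pA := (p_map Sinv phi *%R rhoA).

Let A_module := mul_is_module A.
Let A_comodule := comodule_algebra_comodule hA.

Let rhoL : linear rhoM := coact_linear rhoM_comodule.
Let phiL : linear phi := phi_colinear.1.

Lemma p_coinvA a : coinvariants rhoA (pA a).
Proof.
exact: (p_coinv SK SinvK hA phi_colinear A_module A_comodule (coactM hA)).
Qed.

Lemma mul_phi_p a : \sw_(a0, a1 <- rhoA a) (phi a1 * pA a0) = a.
Proof. exact: (act_phi_p SK SinvK phi_colinear A_module A_comodule). Qed.

Lemma basis_of_coinv B :
    is_basis act (coinvariants rhoA) (coinvariants rhoM) B ->
  is_basis act [set: A] [set: M] B.
Proof.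
move=> hB; pose K := coinvariants rhoA; pose V := coinvariants rhoM.
have K0 : K 0 := coinv0 hA.
have K1 : K 1 := coact1 hA.
have Klin : forall (a : k) x y, K x -> K y -> K (a *: x + y) := coinv_lin hA.
have /choice[co coP] : forall m, exists c, coords act K B (p m) c.
  move=> m; apply: (coords_exists actM_module K0 Klin hB).
  exact: (p_coinv SK SinvK hA phi_colinear actM_module rhoM_comodule).
(* The family [co] comes from choice; uniqueness of coordinates makes it linear all the same. *)
have coL b : linear (fun m => co m b).
  move=> a x y; rewrite (coords_unique actM_module Klin hB (coP _)
    (d := fun b => a *: co x b + co y b)) //.
  rewrite (p_linear SK SinvK phi_colinear actM_module rhoM_comodule).
  exact: coords_lin.
split=> // [m _|s c us sB _ s0 b bs].
  (* Each term of m = φ(m_1) p(m_0) is expanded in [B], with coefficients now anywhere in A. *)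
  have coT i : coords act [set: A] B (act (phi i.2) (p i.1))
      (fun b => phi i.2 * co i.1 b).
    apply: coordsM => //; have [s [*]] := coP i.1; by exists s.
  have [s [us sB _ _ e]] := coords_sum actM_module I (fun _ _ _ _ _ => I)
    (repr (rhoM m)) coT.
  exists s, (fun b => \sum_(i <- repr (rhoM m)) phi i.2 * co i.1 b); split=> //.
  rewrite -e.
  by rewrite -[LHS](act_phi_p SK SinvK phi_colinear actM_module rhoM_comodule).
(* [R] extracts the coefficient of [b]. *)
pose R m := \sw_(m0, m1 <- rhoM m) (phi m1 * co m0 b).
have Fb : bilinear_for *:%R *:%R (fun (m : M) (h : H) => phi h * co m b).
  by split=> u a v w; rewrite ?phiL ?coL (mulPl, mulPr).
have RL : linear R by exact: lin_comp (lin_tsum Fb) rhoL.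
(* Since p(a_0 b') = p(a_0) b' with p(a_0) coinvariant, the only coordinate of this vector is
   p(a_0), at b'; then φ(a_1) p(a_0) sums to [a]. *)
have Rb a b' : B b' -> R (act a b') = a * (b == b')%:R.
  move=> Bb'; have hb' := basis_sub hB Bb'.
  rewrite /R (rho_act_coinv actM_module rho_act) // (tsum_comp (lin_tsum Fb)).
  rewrite -[in RHS](mul_phi_p a).
  rewrite (tsum_comp (f := fun x => x * (b == b')%:R)); last first.
    by move=> r x y; rewrite mulPl.
  apply: eq_tsum => x h; rewrite (tsum_pureE Fb) -mulrA; congr (_ * _).
  rewrite (coords_unique actM_module Klin hB (coP _)
    (d := fun b => pA x * (b == b')%:R)) //.
  rewrite (p_act_coinv SK SinvK phi_colinear actM_module rho_act) //.
  apply: (coordsM actM_module (coinvM hA)); first exact: p_coinvA.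
  exact: (coords_mem actM_module K0 K1).
have := congr1 R s0; rewrite (lin0 RL) (lin_sum RL) (bigD1_seq b) //= big1_seq.
  by rewrite Rb ?eqxx ?mulr1 ?addr0 //; exact: sB.
by move=> b' /andP[b'b b's];
  rewrite Rb; [rewrite eq_sym (negPf b'b) mulr0|exact: sB].
Qed.

End Freeness.

(** * Existence of bases *)

Section BasisExists.
Variables (k : fieldType) (A : comAlgType k) (M : lmodType k).
Variables (act : A -> M -> M) (K : set A).
Hypothesis act_module : is_module act.

Let actl : forall m, linear (act^~ m) := act_linearl act_module.
Let actr : forall a, linear (act a) := act_linearr act_module.

(** Among finitely many members of a chain, one contains the others. The empty list stands apart
    because the chain may have no member. *)
Lemma total_on_bigcup_seq (T : eqType) (F : set (set T)) (s : seq T) :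
    total_on F subset -> (forall b, b \in s -> (\bigcup_(X in F) X) b) ->
  s = [::] \/ exists2 X, F X & forall b, b \in s -> X b.
Proof.
move=> tF; elim: s => [|x s IH] sF; first by left.
have [X FX Xx] := sF x (mem_head _ _); right.
have [b bs|s0|[Y FY sY]] := IH; first by apply: sF; rewrite inE bs orbT.
  by exists X => // b; rewrite s0 inE => /eqP->.
have [XY|YX] := tF X Y FX FY.
  by exists Y => // b; rewrite inE => /predU1P[->|]; [exact: XY|exact: sY].
by exists X => // b; rewrite inE => /predU1P[->//|/sY]; exact: YX.
Qed.

(** Zorn gives a maximal [K]-free subset of [V]. A vector outside its span could be adjoined: a
    relation with a nonzero coefficient there can be solved for that vector, with coefficients of
    the form -(xy). *)
Lemma field_basis_exists V :
    (forall x y, K x -> K y -> K (- (x * y))) ->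
    (forall a, K a -> a <> 0 -> exists2 b, K b & b * a = 1) ->
    K 1 ->
  exists B, is_basis act K V B.
Proof.
move=> KN Kinv K1.
pose free (B : set M) := forall (s : seq M) (c : M -> A), uniq s ->
  (forall b, b \in s -> B b) -> (forall b, b \in s -> K (c b)) ->
  \sum_(b <- s) act (c b) b = 0 -> forall b, b \in s -> c b = 0.
have [F FP totF|B [[BV Bfree] Bmax]] :=
    @Zorn_bigcup _ [set B | B `<=` V /\ free B].
  split=> [b [X /FP[XV _]]|s c us sF sK s0 b bs]; first exact: XV.
  have [e|[X /FP[_ Xf] sX]] := total_on_bigcup_seq totF sF.
    by rewrite e in bs.
  exact: (Xf s c us).
exists B; split=> // v Vv; apply: contrapT => nspan.
have nBv : ~ B v.
  move=> Bv; apply: nspan; exists [:: v], (fun=> 1); split=> // [b|].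
    by rewrite inE => /eqP->.
  by rewrite big_seq1 (act1 act_module).
apply: (Bmax (B `|` [set v])).
  split; first by move=> b; left.
  by move=> /(_ v (or_intror erefl)).
split=> [b [/BV//|->//]|s c us sB sK s0].
have sB' b : b \in s -> b != v -> B b by move=> /sB[//|/= ->]; rewrite eqxx.
have [vs|vs] := boolP (v \in s); last first.
  apply: Bfree => // b bs; apply: sB' => //.
  by apply: contraNneq vs => <-.
have remB b : b \in rem v s -> [/\ b \in s, b != v & B b].
  by rewrite mem_rem_uniq // inE => /andP[/= bv bs]; split=> //; exact: sB'.
move: s0; rewrite (big_rem v) //= => s0.
have cv0 : c v = 0.
  apply: contrapT => /(Kinv _ (sK v vs))[d Kd dc]; apply: nspan.
  exists (rem v s), (fun b => - (d * c b)).
  split=> [b /remB[]//|b /remB[/sK Kb _ _]|].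
    exact: KN.
  apply/eqP; rewrite -subr_eq0; apply/eqP.
  transitivity (act d (act (c v) v + \sum_(y <- rem v s) act (c y) y)).
    rewrite (linD (actr d)) -(actM act_module) dc (act1 act_module).
    congr (_ + _); rewrite (lin_sum (actr d)) -sumrN; apply: eq_bigr => b _.
    by rewrite (linN (actl b)) opprK (actM act_module).
  by rewrite s0 (lin0 (actr d)).
move=> b bs; have [->//|bv] := eqVneq b v.
apply: (Bfree (rem v s) c (rem_uniq _ us)) => [x /remB[]//|x /remB[/sK]//||].
  by move: s0; rewrite cv0 (act0m act_module) add0r.
by rewrite mem_rem_uniq // inE bv.
Qed.

End BasisExists.

(** * Invariance of the rank *)

Section Cardinals.

Lemma card_le_injP (U : Type) (T : pointedType) (Y : set U) (X : set T) :
  Y #<= X <-> exists2 f : U -> T, set_fun Y X f & set_inj Y f.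
Proof. by rewrite -injfunPex; split=> [/pcard_leP|]//; move/pcard_leP. Qed.

Lemma infinite_countable_subset (T : pointedType) (X : set T) :
  infinite_set X -> exists C, [/\ C `<=` X, infinite_set C & countable C].
Proof.
move=> /infiniteP/card_le_injP[f fX finj]; exists (f @` setT).
split=> [_ [n _ <-]||]; first exact: fX.
- by apply/infiniteP/card_le_injP; exists f => // n _; exists n.
- exact: card_le_trans (card_image_le _ _) _.
Qed.

(* Up to finitely many points, an infinite set is a disjoint union of countably
   infinite ones, by Zorn. *)
Lemma countable_partition (T : pointedType) (X : set T) : infinite_set X ->
  exists part : T -> set T, forall x, X x ->
    [/\ infinite_set (part x), part x `<=` X,
        forall y, X y -> part x `&` part y !=set0 -> part x = part y &
        countable [set y | X y /\ part y = part x]].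
Proof.
move=> Xinf.
pose P (F : set (set T)) :=
  (forall C, F C -> [/\ C `<=` X, infinite_set C & countable C]) /\
  (forall C D, F C -> F D -> C `&` D !=set0 -> C = D).
have [F FP totF|F [[F1 F2] Fmax]] := @Zorn_bigcup _ P.
  split=> [C [G /FP[G1 _]]|C D [G FG GC] [G' FG' GD]]; first exact: G1.
  have [GG'|GG'] := totF _ _ FG FG'.
    by apply: (FP G' FG').2 => //; exact: GG'.
  by apply: (FP G FG).2 => //; exact: GG'.
(* [R] holds the points left uncovered by the maximal family; if it were infinite, a countably
   infinite subset of it would enlarge the family. *)
pose R := X `\` \bigcup_(C in F) C.
have Rfin : finite_set R.
  apply: contrapT => /infinite_countable_subset[C [CR Cinf Ccnt]].
  have [x Cx] : C !=set0.
    by apply/set0P/negP => /eqP C0; apply: Cinf; rewrite C0.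
  have disj D : F D -> C `&` D !=set0 -> C = D.
    by move=> FD [y [/CR[_ nF] Dy]]; case: nF; exists D.
  apply: (Fmax (F `|` [set C])).
    split=> [D FD|/(_ C (or_intror erefl)) FC]; first by left.
    by have [_ []] := CR x Cx; exists C.
  split=> [D [/F1//|->]|D E [FD|->] [FE|->] //].
  - by split=> // y /CR[].
  - exact: F2.
  - by rewrite setIC => /disj-> .
  - exact: disj.
have [C0 FC0] : F !=set0.
  apply/set0P/negP => /eqP F0; apply: Xinf; apply: sub_finite_set Rfin => x Xx.
  by split=> // -[C]; rewrite F0.
(* Leftover points are assigned to the fixed block [C0], so each fibre of [part] lies in the union
   of one block and the finite set [R]. *)
have /choice[part partP] : forall x, exists C, X x ->
    F C /\ (C x \/ (R x /\ C = C0)).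
  move=> x; have [[C FC Cx]|nF] := pselect ((\bigcup_(C in F) C) x).
    by exists C => _; split=> //; left.
  by exists C0 => Xx; split=> //; right.
exists part => x Xx; have [Fx _] := partP x Xx; have [sub inf cnt] := F1 _ Fx.
split=> // [y /partP[Fy _]|]; first exact: F2.
have cntR : countable (part x `|` R).
  rewrite -bigcup2E; apply: bigcup_countable => // -[|[|n]] _ //=.
  exact: finite_set_countable.
apply: sub_countable cntR; apply: subset_card_le => y [Xy <-].
by have [_ [|[]]] := partP y Xy; [left|right].
Qed.

(** The points of [Y] sent by [g] into one class of [part] form a countable union of countable sets,
    hence inject into the infinite block of that class. Distinct blocks are disjoint, so these
    injections glue. *)
Lemma card_le_countable_fibers (T U : Type) (X : set T) (Y : set U)
    (g : U -> T) : infinite_set X -> set_fun Y X g ->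
    (forall x, X x -> countable [set y | Y y /\ g y = x]) ->
  Y #<= X.
Proof.
(* The empty type is split off: elsewhere a default point is available for the choice of maps. *)
elim/Ppointed: T => T in X g *; first by rewrite emptyE => /(_ (finite_set0 _)).
move=> Xinf gX gcnt; have [part partP] := countable_partition Xinf.
pose Q C := [set y | Y y /\ part (g y) = C].
have /choice[h hP] : forall C, exists f : U -> T,
    (exists2 x, X x & C = part x) -> set_fun (Q C) C f /\ set_inj (Q C) f.
  move=> C; have [[x Xx ->]|nC] := pselect (exists2 x, X x & C = part x);
    last first.
    by exists (fun=> point) => /nC.
  have [inf _ _ cnt] := partP x Xx.
  suff /card_le_injP[f f1 f2] : Q (part x) #<= part x by exists f.
  apply: card_le_trans ((infiniteP _).1 inf).
  have := bigcup_countable (F := fun z => [set y | Y y /\ g y = z]) cnt.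
  move=> /(_ (fun i Xi => gcnt i Xi.1)); apply: sub_countable.
  apply: subset_card_le => y [Yy yx]; exists (g y) => //.
  by split=> //; exact: gX.
have hQ y : Y y -> Q (part (g y)) y by [].
have hp y : Y y -> set_fun (Q (part (g y))) (part (g y)) (h (part (g y))) /\
    set_inj (Q (part (g y))) (h (part (g y))).
  by move=> Yy; apply: hP; exists (g y) => //; exact: gX.
apply/card_le_injP; exists (fun y => h (part (g y)) y) => [y Yy|y z].
  have [_ sub _ _] := partP _ (gX _ Yy); apply: sub.
  by apply: (hp y Yy).1; exact: hQ.
rewrite !inE => Yy Yz e.
have [_ _ disj _] := partP _ (gX _ Yy).
(* A common value lies in both blocks, so they coincide and injectivity within one block applies. *)
have eyz : part (g y) = part (g z).
  apply: disj; first exact: gX.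
  exists (h (part (g y)) y); split; first by apply: (hp y Yy).1; exact: hQ.
  by rewrite e; apply: (hp z Yz).1; exact: hQ.
apply: (hp y Yy).2; [exact: mem_set| |by rewrite e eyz].
by apply: mem_set; rewrite eyz; exact: hQ.
Qed.

End Cardinals.

Section Rank.
Variables (k : fieldType) (A : comAlgType k) (M : lmodType k).
Variable act : A -> M -> M.
Hypothesis act_module : is_module act.

(* Each b in B occurs in the B-coordinates of some g(b) in B', and g has finite
   fibres, which settles the case where B' is infinite; otherwise the two change
   of basis matrices are mutually inverse. *)
Lemma basis_card_le B B' :
    is_basis act [set: A] [set: M] B -> is_basis act [set: A] [set: M] B' ->
  B #<= B'.
Proof.
move=> hB hB'.
pose cs := @coords k A M act [set: A].
have coordsP (D : set M) : is_basis act [set: A] [set: M] D ->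
    exists co, forall m, cs D m (co m).
  move=> hD; have /choice[co coP] : forall m, exists c, cs D m c.
    move=> m; exact: (coords_exists act_module I (fun _ _ _ _ _ => I) hD I).
  by exists co.
have uniq_coords D m c d : is_basis act [set: A] [set: M] D ->
    cs D m c -> cs D m d -> c =1 d.
  move=> hD; exact: (coords_unique act_module (fun _ _ _ _ _ => I) hD).
have [co coP] := coordsP B hB; have [co' coP'] := coordsP B' hB'.
(* Expanding [b] in [B'] and then each vector back in [B] gives the coordinates of [b] itself. Any
   [t] containing the support will do, in particular an enumeration of a finite [B']. *)
have change b y (t : seq M) : B b -> uniq t ->
    (forall x, x \notin t -> co' b x = 0) ->
  \sum_(x <- t) co' b x * co x y = (y == b)%:R.
  move=> Bb ut t0; have [s [us sB' s0 _ bE]] := coP' b.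
  have e : b = \sum_(x <- t) act (co' b x) x.
    pose u := undup (s ++ t); have uu : uniq u := undup_uniq _.
    have su : {subset s <= u} by move=> x xs; rewrite mem_undup mem_cat xs.
    have tu : {subset t <= u} by move=> x xt; rewrite mem_undup mem_cat xt orbT.
    rewrite (big_support act_module ut uu tu t0).
    by rewrite -(big_support act_module us uu su s0).
  have h1 : cs B b (fun y => \sum_(x <- t) co' b x * co x y).
    rewrite {1}e; apply: (coords_sum act_module I (fun _ _ _ _ _ => I)) => x.
    exact: (coordsM act_module (fun _ _ _ _ => I) I (coP x)).
  exact: (uniq_coords _ _ _ _ hB h1 (coords_mem act_module I I Bb)).
(* If [b] occurred in the expansion of no element of [B'], its own coordinate 1 would be 0. *)
have meet b : B b -> exists2 x, B' x & co x b <> 0.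
  move=> Bb; apply: contrapT => nx.
  have [s [us sB' s0 _ _]] := coP' b.
  have := change b b s Bb us s0.
  rewrite big1_seq ?eqxx => [/esym/eqP|x /andP[_ xs]].
    by rewrite oner_eq0.
  have [->|/eqP x0] := eqVneq (co x b) 0; first by rewrite mulr0.
  by case: nx; exists x => //; exact: sB'.
have supp_fin x : finite_set [set b | co x b <> 0].
  have [s [_ _ s0 _ _]] := coP x; apply: sub_finite_set (finite_seq s) => b /= cb.
  by apply: contrapT => /negP /s0.
have [B'fin|B'inf] := pselect (finite_set B'); last first.
  have /choice[g gP] : forall b, exists x, B b -> B' x /\ co x b <> 0.
    move=> b; have [/meet[x B'x xb]|nB] := pselect (B b); first by exists x.
    by exists 0.
  apply: (card_le_countable_fibers (g := g)) => // [b /gP[]//|x B'x].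
  apply: finite_set_countable; apply: sub_finite_set (supp_fin x) => b /= [Bb <-].
  by case: (gP b Bb).
(* With [B'] finite, [B] lies in a finite union of finite supports. *)
have [s [us sE]] : exists s, uniq s /\ B = [set` s].
  suff /finite_seqP[s ->] : finite_set B.
    exists (undup s); rewrite undup_uniq; split=> //.
    by apply/seteqP; split=> x /=; rewrite mem_undup.
  apply: (@sub_finite_set _ _ (\bigcup_(x in B') [set b | co x b <> 0])).
    by move=> b /meet[x B'x xb]; exists x.
  exact: bigcup_finite.
have [t [ut tE]] : exists t, uniq t /\ B' = [set` t].
  have /finite_seqP[t ->] := B'fin.
  exists (undup t); rewrite undup_uniq; split=> //.
  by apply/seteqP; split=> x /=; rewrite mem_undup.
(* By [change], P Q = 1 over the nonzero commutative ring A, so P has at most as many rows as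
   columns. *)
have le_st : (size s <= size t)%N.
  pose P := \matrix_(i < size s, j < size t) co' s`_i t`_j.
  pose Q := \matrix_(j < size t, l < size s) co t`_j s`_l.
  apply: (@mulmx1_min _ _ _ P Q); apply/matrixP => i l; rewrite !mxE.
  have Bi : B s`_i by rewrite sE /=; exact: mem_nth.
  transitivity (\sum_(x <- t) co' s`_i x * co x s`_l).
    by rewrite (big_nth 0) big_mkord; apply: eq_bigr => j _; rewrite !mxE.
  rewrite change // => [|x xt]; first by rewrite nth_uniq // eq_sym.
  have [r [_ rB' r0 _ _]] := coP' s`_i; apply: r0.
  by apply: contra xt => /rB'; rewrite tE.
have /injfunPex[f] : exists2 f : M -> M, set_fun B B' f & set_inj B f.
  rewrite sE tE; exists (fun x => t`_(index x s)) => [x /= xs|x y].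
    by apply: mem_nth; apply: leq_trans le_st; rewrite index_mem.
  rewrite !inE /= => xs ys /eqP; rewrite nth_uniq //; last first.
  - by apply: leq_trans le_st; rewrite index_mem.
  - by apply: leq_trans le_st; rewrite index_mem.
  by move=> /eqP/(congr1 (nth 0 s)); rewrite !nth_index.
exact: inj_card_le.
Qed.

End Rank.

(* The principal ideal aA is a Poisson 3-Lie H-ideal, hence equal to A. *)
Lemma coinv_center_inverse (k : fieldType) (H : algType k)
    (hopf : hopf_algebra H) (A : comAlgType k) (br : A -> A -> A -> A)
    (rhoA : A -> A ⊗ H) (a : A) :
    is_comodule_poisson_3lie hopf br rhoA -> poisson_H_simple br rhoA ->
    center_3lie br a -> coinvariants rhoA a -> a <> 0 ->
  exists2 b, coinvariants rhoA b & b * a = 1.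
Proof.
move=> [hbr hA _] simple ca ha a0.
have A_module := mul_is_module A.
have rho_mula b : rhoA (b * a) = \sw_(b0, b1 <- rhoA b) ((b0 * a) ⊗ b1).
  exact: (rho_act_coinv A_module (coactM hA)).
have rot x y u : br u x y = br x y u.
  by rewrite (br_skew12 hbr) (br_skew23 hbr) opprK.
have ideal : is_poisson_3lie_H_ideal br rhoA [set x | exists b, x = b * a].
  split=> [|x y [b ->] [c ->]|c x [b ->]|x c d [b ->]|x [b ->]].
  - by exists 0; rewrite mul0r.
  - by exists (b + c); rewrite mulrDl.
  - by exists (c * b); rewrite mulrA.
  (* Centrality of [a] kills one of the two Leibniz terms. *)
  - exists (br c d b); rewrite rot (br_leibniz hbr) -(rot _ _ a) ca.
    by rewrite mulr0 add0r.
  exists [seq (q.1 * a, q.2) | q <- repr (rhoA b)]; split.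
    by move=> _ /mapP[q _ ->]; exists q.1.
  by rewrite rho_mula /tsum /fsum big_map.
have [I0|IT] := simple _ ideal.
  have : [set x | exists b, x = b * a] a by exists 1; rewrite mul1r.
  by rewrite I0.
have [b ba] : [set x | exists b, x = b * a] 1 by rewrite IT.
exists b => //; rewrite /coinvariants /=.
have Fb : bilinear_for *:%R *:%R (fun (x : A) (h : H) => (x * b) ⊗ h).
  by split=> u c x y; rewrite ?mulPl ?purePl ?purePr.
(* The inverse is coinvariant because ρ(b) = ρ(b)(ab ⊗ 1) = ρ(ba)(b ⊗ 1) = b ⊗ 1. *)
transitivity (\sw_(x, h <- rhoA (b * a)) ((x * b) ⊗ h)).
  rewrite rho_mula (tsum_comp (lin_tsum Fb)) -[LHS]tsum_pure_id.
  apply: eq_tsum => x h.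
  by rewrite (tsum_pureE Fb) -mulrA [a * b]mulrC -ba mulr1.
by rewrite -ba (coact1 hA) (tsum_pureE Fb) mul1r.
Qed.

Unset Implicit Arguments.

Theorem corollary3p9
  (k : fieldType) (char0 : [pchar k] =i pred0)
  (H : algType k) (hopf : hopf_algebra H)
  (Sinv : H -> H)
  (SK : cancel (antipode hopf) Sinv) (SinvK : cancel Sinv (antipode hopf))
  (A : comAlgType k) (br : A -> A -> A -> A) (rhoA : A -> A ⊗ H)
  (hA : is_comodule_poisson_3lie hopf br rhoA)
  (simpleA : poisson_H_simple br rhoA)
  (M : lmodType k) (act : A -> M -> M) (dia : A -> A -> M -> M)
  (rhoM : M -> M ⊗ H)
  (hM : is_poisson_3lie_hopf_module hopf br rhoA act dia rhoM)
  (phi : {lrmorphism H -> A})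
  (phi_inv : forall h, center_3lie br (phi h))
  (phi_colinear : colinear (comul hopf) rhoA phi)
  (trivM : forall x y m, coinvariants rhoM m ->
     dia' Sinv phi act dia rhoM x y m = 0)
  (trivA : forall x y a, coinvariants rhoA a ->
     dia' Sinv phi *%R br rhoA x y a = 0) :
  let K := center_3lie br `&` coinvariants rhoA in
  let V := lie_invariants dia `&` coinvariants rhoM in
  [/\ exists B, is_basis act [set: A] [set: M] B,
      exists B, is_basis act K V B &
      forall B B', is_basis act [set: A] [set: M] B ->
        is_basis act K V B' -> B #= B'].
Proof.
have hAc := comodule_poisson_algebra hA.
have hbr := comodule_poisson hA.
have act_module := poisson_module (hopf_module_poisson hM).
have rhoM_comodule := hopf_module_comodule hM.
have diaL := dia_trilinear (poisson_3lie_module (hopf_module_poisson hM)).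
(* A is taken as a module over itself; skew-symmetry moves the coinvariant element from the first
   slot to the third. *)
have center_coinv a : coinvariants rhoA a -> center_3lie br a.
  move=> ha x y; rewrite (br_skew12 hbr) (br_skew23 hbr) opprK.
  exact: (dia_coinv_eq0 SK SinvK phi_colinear (mul_is_module A)
    (comodule_algebra_comodule hAc) (br_trilinear hbr) (coact_br hA) trivA).
have inv_coinv m : coinvariants rhoM m -> lie_invariants dia m.
  move=> hm x y; exact: (dia_coinv_eq0 SK SinvK phi_colinear act_module
    rhoM_comodule diaL (coact_dia hM) trivM).
move=> K V.
have -> : K = coinvariants rhoA.
  by apply/seteqP; split=> [a []//|a ha]; split=> //; exact: center_coinv.
have -> : V = coinvariants rhoM.
  by apply/seteqP; split=> [m []//|m hm]; split=> //; exact: inv_coinv.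
have lift B : is_basis act (coinvariants rhoA) (coinvariants rhoM) B ->
    is_basis act [set: A] [set: M] B.
  exact: (basis_of_coinv SK SinvK hAc phi_colinear act_module rhoM_comodule
    (coact_act hM)).
have [B hB] : exists B,
    is_basis act (coinvariants rhoA) (coinvariants rhoM) B.
  apply: (field_basis_exists act_module) => [x y hx hy|a ha|].
  - rewrite -scaleN1r -[_ *: _]addr0.
    exact: (coinv_lin hAc _ (coinvM hAc hx hy) (coinv0 hAc)).
  - by apply: (coinv_center_inverse hA simpleA) => //; exact: center_coinv.
  - exact: coact1 hAc.
(* A basis of the invariants is itself an A-basis of M, so the rank statement compares two bases of
   the same module. *)
split; [by exists B; exact: lift|by exists B|move=> B1 B2 h1 /lift h2].
by rewrite card_eq_le !(basis_card_le act_module).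
Qed.
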